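(* Let $D$ be a digraph on $\{1,\dots,n\}$ (as in the context). If $D$ is bipartite, then $D$ is invertible and $D$ is a subgraph of $D^+$.
   Context: Digraphs $D$ are finite, with vertex set $\{1,\dots,n\}$, may have multiple edges but no loops, and every directed edge $i\to j$ satisfies $i<j$. $B=B_D$ is the $n\times n$ upper unitriangular integer matrix with $B_{i,i}=1$ and $B_{i,j}$ equal to the number of edges from $i$ to $j$ for $i\ne j$. $D$ is invertible if there is a diagonal matrix $S$ with diagonal entries in $\{\pm1\}$ such that $SB^{-1}S=|B^{-1}|$, where $|\cdot|$ is the componentwise absolute value. The parity closure $D^+$ is the digraph on $\{1,\dots,n\}$ with exactly $|B^{-1}_{i,j}|$ edges from $i$ to $j$ for each $i<j$. Being a subgraph is meant with multiplicities: for all $i<j$ the number of edges $i\to j$ in $D$ is at most that in $D^+$. A digraph is called bipartite if its underlying undirected graph is. *)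

(* Defs.v *)
From mathcomp Require Import all_boot all_order all_algebra.

Set Implicit Arguments.
Unset Strict Implicit.
Unset Printing Implicit Defensive.

Import Order.TTheory GRing.Theory Num.Theory.
Local Open Scope ring_scope.

(* The vertex set {1, ..., n} is represented by 'I_n = {0, ..., n-1}, with its
   usual order; [edges D i j] is the number of edges from i to j. *)
Record digraph (n : nat) := Digraph {
  edges : 'I_n -> 'I_n -> nat;
  edges_lt : forall i j : 'I_n, (0 < edges i j)%N -> (i < j)%N
}.

Definition digraph_mx (n : nat) (D : digraph n) : 'M[int]_n :=
  \matrix_(i, j) (if i == j then 1 else (edges D i j)%:Z).

(* Hence [invmx (digraph_mx D)] is a genuine inverse, not the default value
   that [invmx] takes on singular matrices. *)
Lemma digraph_mx_unit (n : nat) (D : digraph n) : digraph_mx D \in unitmx.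
Proof.
rewrite -unitmx_tr unitmxE det_trig.
  by rewrite big1 ?unitr1 // => i _; rewrite !mxE eqxx.
apply/is_trig_mxP => i j lt_ij; rewrite !mxE.
case: eqVneq => [eq_ji | _]; first by rewrite eq_ji ltnn in lt_ij.
case E: (edges D j i) => [//|m].
have := @edges_lt _ D j i; rewrite E => /(_ isT) lt_ji.
by have := ltn_trans lt_ij lt_ji; rewrite ltnn.
Qed.

Definition abs_mx (m n : nat) (A : 'M[int]_(m, n)) : 'M[int]_(m, n) :=
  map_mx (fun x : int => `|x|) A.

Definition invertible (n : nat) (D : digraph n) : Prop :=
  exists S : 'M[int]_n,
    [/\ is_diag_mx S,
        forall i : 'I_n, S i i = 1 \/ S i i = -1
      & S *m invmx (digraph_mx D) *m S = abs_mx (invmx (digraph_mx D))].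

Definition parity_closure_edges (n : nat) (D : digraph n) (i j : 'I_n) : nat :=
  if (i < j)%N then `|invmx (digraph_mx D) i j|%N else 0%N.

Lemma parity_closure_edges_lt (n : nat) (D : digraph n) (i j : 'I_n) :
  (0 < parity_closure_edges D i j)%N -> (i < j)%N.
Proof. by rewrite /parity_closure_edges; case: ifP. Qed.

Definition parity_closure (n : nat) (D : digraph n) : digraph n :=
  Digraph (@parity_closure_edges_lt n D).

Definition subgraph (n : nat) (D E : digraph n) : Prop :=
  forall i j : 'I_n, (i < j)%N -> (edges D i j <= edges E i j)%N.

Definition adjacent (n : nat) (D : digraph n) : rel 'I_n :=
  fun i j => (0 < edges D i j)%N || (0 < edges D j i)%N.

Definition bipartite (n : nat) (D : digraph n) : Prop :=
  exists X : {set 'I_n},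
    forall i j : 'I_n, adjacent D i j -> (i \in X) != (j \in X).

(* Main.v *)
Require Import Defs.
From mathcomp Require Import all_boot all_order all_algebra.

(** Write [B = 1 + A], where [A] is the adjacency matrix: nonnegative and
    strictly upper triangular. Let [S] be the diagonal sign matrix that tells
    the two colour classes apart. Each edge joins the two classes, so
    [S *m A *m S = - A]; hence [S *m B *m S = 1 - A], and inverting gives
    [S *m B^-1 *m S = (1 - A)^-1 =: M], the matrix that counts directed walks.
    The recursion [M = 1 + A *m M] shows that [M] is nonnegative
    ([walk_mx_ge1]) and that it dominates [A] ([walk_mx_ge_adj]).
    Conjugation by signs does not change absolute values, so [M = |B^-1|]:
    nonnegativity of [M] is the invertibility of the digraph, and [A <= M] says
    that it is a subgraph of its parity closure. *)

Set Implicit Arguments.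
Unset Strict Implicit.
Unset Printing Implicit Defensive.

Import Order.TTheory GRing.Theory Num.Theory.
Local Open Scope ring_scope.

Section WalkMatrix.

Variables (R : numDomainType) (n : nat) (A M : 'M[R]_n).
Hypothesis A_ge0 : forall i j, 0 <= A i j.
Hypothesis A_upper : forall i j : 'I_n, (j <= i)%N -> A i j = 0.
Hypothesis M_rec : M = 1%:M + A *m M.

(** Row [i] of [M = 1 + A *m M] only involves the rows of [M] of larger index,
    so nonnegativity propagates from the last row upwards. *)
Lemma walk_mx_ge1 i j : (i == j)%:R <= M i j.
Proof.
have [m] := ubnP (n - i); elim: m => // m IHm in i * => lt_ni_m.
rewrite {1}M_rec !mxE lerDl sumr_ge0 // => k _.
have [le_ki | lt_ik] := leqP k i; first by rewrite A_upper ?mul0r.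
apply/mulr_ge0 => //; apply: le_trans (IHm k _); first exact: ler0n.
by apply: leq_trans (_ : n - i <= m)%N; first rewrite ltn_sub2l.
Qed.

Lemma walk_mx_ge0 i j : 0 <= M i j.
Proof. exact: le_trans (ler0n R _) (walk_mx_ge1 i j). Qed.

(** The term [A i j * M j j] alone suffices, since [M j j >= 1]. *)
Lemma walk_mx_ge_adj i j : A i j <= M i j.
Proof.
have M_jj := walk_mx_ge1 j j; rewrite eqxx in M_jj.
rewrite {1}M_rec !mxE (bigD1 j) //= addrCA.
apply: le_trans (ler_peMr (A_ge0 i j) M_jj) _; rewrite lerDl addr_ge0 ?ler0n //.
by apply: sumr_ge0 => k _; rewrite mulr_ge0 ?walk_mx_ge0.
Qed.

End WalkMatrix.

Definition sign_mx n (X : {set 'I_n}) : 'M[int]_n :=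
  diag_mx (\row_i (-1) ^+ (i \in X)).

Lemma sign_mx_conjE n (X : {set 'I_n}) (A : 'M[int]_n) i j :
  (sign_mx X *m A *m sign_mx X) i j = (-1) ^+ ((i \in X) (+) (j \in X)) * A i j.
Proof. by rewrite mul_mx_diag mul_diag_mx !mxE mulrAC signr_addb. Qed.

Lemma sign_mxK n (X : {set 'I_n}) : sign_mx X *m sign_mx X = 1%:M.
Proof.
apply/matrixP => i j; rewrite -[X in X *m _]mulmx1 sign_mx_conjE mxE.
by case: eqVneq => [->|_]; rewrite ?addbb ?mulr1 ?mulr0.
Qed.

Definition adjacency_mx n (D : digraph n) : 'M[int]_n :=
  \matrix_(i, j) (edges D i j)%:Z.

Lemma edges_upper n (D : digraph n) (i j : 'I_n) :
  (j <= i)%N -> edges D i j = 0%N.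
Proof.
by apply: contraTeq; rewrite -lt0n -ltnNge; apply: edges_lt.
Qed.

Lemma digraph_mxE n (D : digraph n) : digraph_mx D = 1%:M + adjacency_mx D.
Proof.
apply/matrixP => i j; rewrite !mxE.
by case: eqVneq => [->|_]; rewrite ?add0r // edges_upper ?addr0.
Qed.

(** With [S] the sign matrix, [S *m B = (1 - A) *m S]; multiplying by
    [B^-1 *m S] on the right gives [1 = (1 - A) *m (S *m B^-1 *m S)]. *)
Lemma sign_conj_inv_rec n (D : digraph n) (X : {set 'I_n})
    (M := sign_mx X *m invmx (digraph_mx D) *m sign_mx X) :
    (forall i j, adjacent D i j -> (i \in X) != (j \in X)) ->
  M = 1%:M + adjacency_mx D *m M.
Proof.
move=> colX; set A := adjacency_mx D; set S := sign_mx X in M *.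
have SAS : S *m A *m S = - A.
  apply/matrixP => i j; rewrite sign_mx_conjE !mxE.
  case: (posnP (edges D i j)) => [-> | e_ij]; first by rewrite mulr0 oppr0.
  by rewrite addbC -negb_eqb eq_sym colX ?mulN1r // /adjacent e_ij.
have SB : S *m digraph_mx D = (1%:M - A) *m S.
  rewrite digraph_mxE mulmxDr mulmxBl mulmx1 mul1mx; congr (_ + _).
  by rewrite -[LHS]mulmx1 -(sign_mxK X) mulmxA SAS mulNmx.
apply/eqP; rewrite -subr_eq -[X in X - _]mul1mx -mulmxBl !mulmxA -SB.
by rewrite -(mulmxA S) mulmxV ?digraph_mx_unit // mulmx1 sign_mxK.
Qed.

Theorem corollary3p8 (n : nat) (D : digraph n) :
  bipartite D -> invertible D /\ subgraph D (parity_closure D).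
Proof.
case=> X colX; have M_rec := sign_conj_inv_rec colX.
set M := _ *m sign_mx X in M_rec.
have A_ge0 i j : 0 <= adjacency_mx D i j by rewrite mxE.
have A_upper (i j : 'I_n) : (j <= i)%N -> adjacency_mx D i j = 0.
  by move=> le_ji; rewrite mxE edges_upper.
have M_abs i j : M i j = `|invmx (digraph_mx D) i j|.
  rewrite -[LHS]ger0_norm ?(walk_mx_ge0 A_ge0 A_upper M_rec) //.
  by rewrite sign_mx_conjE normrM normr_sign mul1r.
split=> [|i j lt_ij].
  exists (sign_mx X); split; first exact: diag_mx_is_diag.
    by move=> i; rewrite !mxE eqxx; case: (i \in X); [right | left].
  by apply/matrixP => i j; rewrite [RHS]mxE -M_abs.
rewrite /= /parity_closure_edges lt_ij -lez_nat abszE -M_abs.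
by have := walk_mx_ge_adj A_ge0 A_upper M_rec i j; rewrite mxE.
Qed.
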